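(* Let $\mu\in\mathbb{R}$, $T>0$, $x\in\mathbb{R}$ and $(z,y)\in\mathbb{R}^2$ with $z<y$ be fixed, and let $W$ be a standard one-dimensional Brownian motion started at $0$. Set $\hat X(s)=x-\mu s+W(s)$ for $s\ge 0$. Set $Y(t)=y+\mu t-W(t)$ and $Z(t)=z+\mu t+W(t)$, let $\zeta=\inf\{t\ge 0: Z(t)=Y(t)\}$, and let $X^*(t)=(Z(t),Y(t))$ for $t<\zeta$ and $X^*(t)$ be a coffin state for $t\ge\zeta$. Then $$\mathbf{E}[\Gamma((z,y),\hat X(T))]=\mathbf{E}[\Gamma(X^*(T),x)].$$
   Context: The duality function $\Gamma$ is defined for $(z,y)\in D^*=\{(z,y)\in\mathbb{R}^2: z<y\}$ and $x\in\mathbb{R}$ by $\Gamma((z,y),x)=1$ if $z<x\le y$ and $\Gamma((z,y),x)=0$ otherwise. By convention $\Gamma(X^*(T),x)=0$ if $T\ge\zeta$ (i.e. $\Gamma$ vanishes at the coffin state). *)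

(* Defs.v *)
From HB Require Import structures.
From mathcomp Require Import all_boot all_order all_algebra.
From mathcomp Require Import all_classical all_reals all_analysis.
Import Order.TTheory GRing.Theory Num.Theory.
Import numFieldNormedType.Exports.

Set Implicit Arguments.
Unset Strict Implicit.
Unset Printing Implicit Defensive.

Local Open Scope classical_set_scope.
Local Open Scope ring_scope.

(* Mutual independence of a finite family; the product rule for subfamilies is
   the case where some of the B i are setT. *)
Definition mutually_independent (d : measure_display) (Omega : measurableType d)
    (R : realType) (P : probability Omega R) (I : finType)
    (X : I -> Omega -> R) : Prop :=
  forall B : I -> set R, (forall i, measurable (B i)) ->
    P (\bigcap_i (X i @^-1` B i)) = (\prod_(i : I) P (X i @^-1` B i))%E.

(* Only the restriction of W to times t >= 0 is constrained. In the law of the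
   increments, A ranges over measurable sets because measures take arbitrary
   values elsewhere, and s < t is strict because normal_prob m 0 is not the
   Dirac mass at m. *)
Definition standard_brownian_motion (d : measure_display)
    (Omega : measurableType d) (R : realType) (P : probability Omega R)
    (W : R -> {RV P >-> R}) : Prop :=
  [/\ {ae P, forall w, W 0 w = 0},
      forall (n : nat) (t : nat -> R), 0 <= t 0%N ->
        {homo t : i j / (i <= j)%N >-> i <= j} ->
        mutually_independent P (fun i : 'I_n => W (t i.+1) \- W (t i)),
      forall s t : R, 0 <= s -> s < t -> forall A : set R, measurable A ->
        pushforward P (W t \- W s) A = normal_prob 0 (Num.sqrt (t - s)) A
    & {ae P, forall w, {within `[0, +oo[, continuous (fun t : R => W t w)}}].
Arguments standard_brownian_motion {d Omega R} P W.

Section dual_process.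
Context (R : realType) (Omega : Type).
Implicit Types (W : R -> Omega -> R) (w : Omega).

Definition Xhat (mu x : R) W (s : R) w : R := x - mu * s + W s w.

Definition Yproc (mu y : R) W (t : R) w : R := y + mu * t - W t w.

Definition Zproc (mu z : R) W (t : R) w : R := z + mu * t + W t w.

Definition zeta (mu z y : R) W w : \bar R :=
  ereal_inf [set t%:E | t in
    [set t : R | 0 <= t /\ Zproc mu z W t w = Yproc mu y W t w]].

(* None is the coffin state. *)
Definition Xstar (mu z y : R) W (t : R) w : option (R * R) :=
  if (t%:E < zeta mu z y W w)%E then Some (Zproc mu z W t w, Yproc mu y W t w)
  else None.

(* The formula is used on all pairs; it gives 0 when z >= y. *)
Definition Gamma (p : option (R * R)) (x : R) : R :=
  if p is Some (z, y) then (if z < x <= y then 1 else 0) else 0.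

End dual_process.

(* Main.v *)
Require Import Defs.
From mathcomp Require Import all_boot all_order all_algebra.
From mathcomp Require Import all_classical all_reals all_analysis.
From mathcomp Require Import measurable_realfun lra.
Import Order.TTheory GRing.Theory Num.Theory.
Import numFieldNormedType.Exports.

Set Implicit Arguments.
Unset Strict Implicit.
Unset Printing Implicit Defensive.

Local Open Scope classical_set_scope.
Local Open Scope ring_scope.

(** Put [a = (y - z) / 2]. The drift cancels in [Z t = Y t], so [zeta] is the
    hitting time of [a] by [W], and the right-hand side is the probability that
    [W] stays below [a] on [[0, T]] while [W T < c1] and [W T <= c2], where
    [c1 = x - z - mu T] and [c2 = y + mu T - x]. The left-hand side is the
    probability that [- c1 < W T <= c2]. Since [c1 + c2 = 2 a], the level
    [m = min (c1, c2)] is at most [a] and [2 a - m = max (c1, c2)]. The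
    reflection principle turns the right-hand side into
    [P (W T <= m) - P (W T >= 2 a - m)], which is [F c1 + F c2 - 1] for the
    distribution function [F] of [W T]; so is the left-hand side, because the
    law of [W T] is symmetric and has no atom.

    The reflection principle is proved on the grids [T j / (n + 1)]. At the
    first grid time [k] where the walk reaches [a], the remaining increment is
    independent of the past and symmetric, so that [v k + D] and [v k - D] have
    the same law on that event ([independent_symmetric_swap],
    [brownian_grid_reflection]). Summing over [k] compares the law of the walk
    killed at [a] with the tail beyond [2 a - m], exactly in one direction
    ([discrete_reflection_le]) and up to the overshoot at [a] in the other
    ([discrete_reflection_ge]).

    The limit is taken by two inequalities. A path that never reaches [a] stays
    below it on each grid, and the overshoot exceeds [e] with small probability
    because paths are uniformly continuous on [[0, T]]
    ([killed_expectation_le]). Conversely a path that is below [a - e] on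
    infinitely many grids never reaches [a] ([killed_expectation_ge]). Letting
    [e] tend to 0 gives [killed_expectation]. The killed functional may fail to
    be measurable, since paths are regular only outside a null set; hence the
    bounds compare it with measurable events up to a null set. *)

(** * Symmetry of the centred normal law *)

Section normal_law.
Context (R : realType).
Local Notation mu := (@lebesgue_measure R).

Lemma normal_prob_opp (s : R) (A : set R) : s != 0 -> measurable A ->
  normal_prob 0 s (-%R @^-1` A) = normal_prob 0 s A.
Proof.
move=> s0 mA; rewrite /normal_prob.
have pdfN r : normal_pdf 0 s (- r) = normal_pdf 0 s r.
  by rewrite !normal_pdfE// /normal_fun !subr0 sqrrN.
pose opp : R -> measurableTypeR R := -%R.
transitivity (\int[mu]_(r in opp @^-1` A) (EFin \o normal_pdf 0 s \o opp) r)%E.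
  by apply: eq_integral => r _ /=; rewrite pdfN.
have mopp : measurable_fun [set: measurableTypeR R] opp by exact: oppr_measurable.
rewrite -(@ge0_integral_pushforward _ _ _ _ _ _ mopp)//=.
- by apply: eq_measure_integral => //= B mB _; rewrite (lebesgue_measureN mB).
- by apply/measurable_EFinP/measurable_funTS; exact: measurable_normal_pdf.
- by move=> r _; rewrite lee_fin normal_pdf_ge0.
Qed.

Lemma normal_prob_set1 (s c : R) : normal_prob 0 s [set c] = 0%E.
Proof.
have /null_content_dominatesP := @normal_prob_dominates R 0 s.
by apply => //; exact: lebesgue_measure_set1.
Qed.

End normal_law.

(** * Flipping an independent symmetric increment *)

Section independence.
Context (d : measure_display) (Omega : measurableType d) (R : realType).
Variable P : probability Omega R.

(** Both sides are finite measures in [A], so their agreement on a pi-system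
    extends to the sigma-algebra it generates. *)
Lemma independent_g_sigma (G : set (set Omega)) (E : set Omega) :
  G `<=` measurable -> G setT -> setI_closed G -> measurable E ->
  (forall A, G A -> P (A `&` E) = (P A * P E)%E) ->
  forall A, <<s G >> A -> P (A `&` E) = (P A * P E)%E.
Proof.
move=> Gm GT GI mE GE A sA.
pose m1 := mrestr P mE.
have fE : 0 <= fine (P E) by exact: fine_ge0.
pose m2 := mscale (NngNum fE) P.
have PE : ((fine (P E))%:E = P E)%E by rewrite fineK// fin_num_measure.
have m1E B : m1 B = P (B `&` E) by [].
have m2E B : m2 B = (P B * P E)%E by rewrite /m2/= /mscale/= PE muleC.
rewrite -m1E -m2E.
apply: (@g_sigma_algebra_measure_unique _ _ _ G Gm (fun=> setT)) => //.
- exact: bigcup_const.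
- by move=> B GB; rewrite -[LHS]/(m1 B) -[RHS]/(m2 B) m1E m2E GE.
- move=> k; rewrite -[ltLHS]/(m1 setT) m1E (le_lt_trans (probability_le1 _ _)) ?ltry//.
  exact: measurableI.
Qed.

(** The pairs (past, [D]) and (past, [- D]) have the same law on the product of
    the sigma-algebra of the past with the reals, namely the product of the law
    of the past and the law of [D]. The event compared is measurable for that
    product because [F] and [Y] only depend on the past. *)
Lemma independent_symmetric_swap (G : set (set Omega)) (F : set Omega)
    (Y D : Omega -> R) (c : R) :
  G `<=` measurable -> <<s G >> F ->
  measurable_fun [set: g_sigma_algebraType G] Y ->
  measurable_fun [set: Omega] D ->
  (forall (A : set Omega) (B : set R), <<s G >> A -> measurable B ->
    P (A `&` D @^-1` B) = (P A * P (D @^-1` B))%E) ->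
  (forall B : set R, measurable B -> P ((\- D) @^-1` B) = P (D @^-1` B)) ->
  P (F `&` [set w | Y w + D w <= c]) = P (F `&` [set w | Y w - D w <= c]).
Proof.
move=> Gm sF mY mD ind sym.
pose T' := g_sigma_algebraType G.
have sGm : <<s G >> `<=` @measurable _ Omega.
  by apply: smallest_sub => //; exact: sigma_algebra_measurable.
have mid : measurable_fun [set: Omega] (id : Omega -> T').
  by move=> _ B mB; rewrite setTI preimage_id; exact: sGm.
have mDN : measurable_fun [set: Omega] (fun w => - D w).
  exact: measurableT_comp.
have mp1 : measurable_fun [set: Omega] (fun w => ((w : T'), D w)).
  exact: measurable_fun_pair.
have mp2 : measurable_fun [set: Omega] (fun w => ((w : T'), - D w)).
  exact: measurable_fun_pair.
(* The identity, seen as the map to the coarser sigma-algebra of the past. *)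
pose X1 : {mfun Omega >-> T'} := mfun_Sub (mem_set mid).
pose X2 : {mfun Omega >-> R} := mfun_Sub (mem_set mD).
pose Z1 : {mfun Omega >-> (T' * R)%type} := mfun_Sub (mem_set mp1).
pose Z2 : {mfun Omega >-> (T' * R)%type} := mfun_Sub (mem_set mp2).
pose E := [set p : T' * R | F p.1 /\ Y p.1 + p.2 <= c].
have mE : measurable E.
  have -> : E = (F `*` setT) `&` [set p | Y p.1 + p.2 <= c].
    by apply/seteqP; split => -[w u]; rewrite /E/=; tauto.
  apply: measurableI; first exact: measurableX.
  have mf : measurable_fun setT (fun p : T' * R => Y p.1 + p.2 <= c).
    apply: measurable_fun_ler => //; apply: measurable_funD => //.
    by apply: measurableT_comp => //; exact: measurable_fst.
  by have := mf measurableT [set true] I; rewrite setTI.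
have H1 : (distribution P X1 \x distribution P X2)%E E = distribution P Z1 E.
  by apply: product_measure_unique => // A B mA mB; exact: ind.
have H2 : (distribution P X1 \x distribution P X2)%E E = distribution P Z2 E.
  apply: product_measure_unique => // A B mA mB.
  have mBN : measurable ((-%R : R -> R) @^-1` B).
    by rewrite -[X in measurable X]setTI; exact: oppr_measurable.
  transitivity (P A * P ((\- D)%R @^-1` B))%E; first exact: (ind A _ mA mBN).
  by rewrite sym.
by move: H1; rewrite H2 => /esym.
Qed.

End independence.

(** * First passage and reflection of a discrete-time process *)

Section measurable_comparisons.
Context (d : measure_display) (T : measurableType d) (R : realType).
Implicit Types f g : T -> R.

Lemma measurable_set_ler f g : measurable_fun setT f -> measurable_fun setT g ->
  measurable [set w | f w <= g w].
Proof.
move=> mf mg; have /(_ measurableT [set true] I) := measurable_fun_ler mf mg.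
by rewrite setTI.
Qed.

Lemma measurable_set_ltr f g : measurable_fun setT f -> measurable_fun setT g ->
  measurable [set w | f w < g w].
Proof.
move=> mf mg; have /(_ measurableT [set true] I) := measurable_fun_ltr mf mg.
by rewrite setTI.
Qed.

End measurable_comparisons.

Section first_passage.
Context (d : measure_display) (T : measurableType d) (R : realType).
Implicit Types (v : nat -> T -> R) (a : R) (n k : nat).

Definition first_passage v a k : set T :=
  [set w | a <= v k w /\ forall j, (j < k)%N -> v j w < a].

Definition stays_below v a n : set T :=
  [set w | forall k, (k <= n)%N -> v k w < a].

Definition large_step v e n : set T :=
  [set w | exists2 k, (k < n)%N & v k w + e < v k.+1 w].

Lemma measurable_stays_below v a n :
  (forall k, (k <= n)%N -> measurable_fun setT (v k)) ->
  measurable (stays_below v a n).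
Proof.
move=> mv; rewrite (_ : stays_below v a n =
    \bigcap_(k in `I_n.+1) [set w | v k w < a]); last first.
  by apply/seteqP; split.
by apply: fin_bigcap_measurable => // k /= kn; apply: measurable_set_ltr => //;
  exact: mv.
Qed.

Lemma measurable_first_passage v a k :
  (forall j, (j <= k)%N -> measurable_fun setT (v j)) ->
  measurable (first_passage v a k).
Proof.
move=> mv; rewrite (_ : first_passage v a k = [set w | a <= v k w] `&`
    \bigcap_(j in `I_k) [set w | v j w < a]); last first.
  by apply/seteqP; split.
apply: measurableI; first by apply: measurable_set_ler => //; exact: mv.
by apply: fin_bigcap_measurable => // j /= jk; apply: measurable_set_ltr => //;
  apply: mv; exact: ltnW.
Qed.

Lemma measurable_large_step v e n : (forall k, measurable_fun setT (v k)) ->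
  measurable (large_step v e n).
Proof.
move=> mv; rewrite (_ : large_step v e n =
    \bigcup_(k in `I_n) [set w | v k w + e < v k.+1 w]); last first.
  by apply/seteqP; split.
apply: fin_bigcup_measurable => // k _.
by apply: measurable_set_ltr => //; exact: measurable_funD.
Qed.

Lemma first_passage_exists v a n w :
  ~ stays_below v a n w -> exists2 k, (k <= n)%N & first_passage v a k w.
Proof.
move=> nb.
have [k /andP[kn ak]] : exists k, (k <= n)%N && (a <= v k w).
  apply: contrapT => nk; apply: nb => k kn; rewrite ltNge; apply/negP => ak.
  by apply: nk; exists k; rewrite kn.
have ex : exists k, a <= v k w by exists k.
case: (ex_minnP ex) => j aj minj; exists j; first exact: leq_trans (minj _ ak) kn.
by split => // i ij; rewrite ltNge; apply/negP => /minj; rewrite leqNgt ij.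
Qed.

Lemma trivIset_first_passage v a : trivIset setT (first_passage v a).
Proof.
apply/trivIsetP => i j _ _; wlog ij : i j / (i < j)%N => [wl|_].
  rewrite neq_ltn => /orP[ij|ji]; first by apply: wl; rewrite ?neq_ltn ?ij.
  by rewrite setIC; apply: wl; rewrite ?neq_ltn ?ji.
rewrite -subset0 => w [[ai _] [_ /(_ _ ij)]].
by rewrite ltNge ai.
Qed.

End first_passage.

(** Reversing the path after the first passage [k] turns the endpoint into
    [v k - (v n - v k) = 2 v k - v n], whence the form of [refl]. *)
Section discrete_reflection.
Context (d : measure_display) (Omega : measurableType d) (R : realType).
Variables (P : probability Omega R) (v : nat -> Omega -> R) (a m : R) (n : nat).
Hypothesis mv : forall k, measurable_fun setT (v k).
Hypothesis ma : m <= a.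
Hypothesis refl : forall k, (k <= n)%N ->
  P (first_passage v a k `&` [set w | v n w <= m]) =
  P (first_passage v a k `&` [set w | 2 * v k w - v n w <= m]).

Let reflected := \bigcup_(k in `I_n.+1)
  (first_passage v a k `&` [set w | 2 * v k w - v n w <= m]).

Let mpassage k : measurable (first_passage v a k).
Proof. by apply: measurable_first_passage. Qed.

Let mbelow : measurable (stays_below v a n).
Proof. by apply: measurable_stays_below. Qed.

Let mend : measurable [set w | v n w <= m].
Proof. exact: measurable_set_ler. Qed.

Let mpiece k :
  measurable (first_passage v a k `&` [set w | 2 * v k w - v n w <= m]).
Proof.
apply: measurableI => //; apply: measurable_set_ler => //.
by apply: measurable_funB => //; exact: measurable_funM.
Qed.

Let mreflected : measurable reflected.
Proof. exact: fin_bigcup_measurable. Qed.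

Let measure_reflected :
  P ([set w | v n w <= m] `\` stays_below v a n) = P reflected.
Proof.
rewrite (_ : _ `\` _ = \bigcup_(k in `I_n.+1)
    (first_passage v a k `&` [set w | v n w <= m])).
  rewrite !measure_fin_bigcup//.
  - by apply: eq_fsbigr => k; rewrite inE => kn; exact: refl.
  - by move=> i j _ _ [w [[wi _] [wj _]]];
      apply: (@trivIset_first_passage _ _ _ v a) => //; exists w.
  - by move=> i j _ _ [w [[wi _] [wj _]]];
      apply: (@trivIset_first_passage _ _ _ v a) => //; exists w.
  - by move=> k _; exact: measurableI.
apply/seteqP; split => [w [vm /first_passage_exists[k kn wk]]|].
  by exists k.
move=> w [k /= kn [[ak _] vm]]; split => // /(_ k kn).
by rewrite ltNge ak.
Qed.

Let split_below : P [set w | v n w <= m] =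
  (P reflected + P ([set w | (v n w <= m)%R] `&` stays_below v a n))%E.
Proof. by rewrite -measure_reflected -measureDI. Qed.

(** A path that ends below [m] after reaching [a] is reflected to one that ends
    above [2 v k - m], hence above [2 a - m]. *)
Lemma discrete_reflection_le :
  (P [set w | (v n w <= m)%R] <= P [set w | (2 * a - m <= v n w)%R] +
    P ([set w | (v n w <= m)%R] `&` stays_below v a n))%E.
Proof.
rewrite split_below; apply: leeD2r; apply: le_measure; rewrite ?inE//.
  exact: measurable_set_ler.
move=> w [k /= kn [[ak _] vm]] /=; lra.
Qed.

(** A path ending above [2 a + 2 e - m] has crossed [a]; unless it made a step
    larger than [e], it was at most [a + e] at the first passage, so that it is
    the reflection of a path ending below [m]. *)
Lemma discrete_reflection_ge (e : R) : 0 <= e -> (forall w, v 0%N w < a) ->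
  (P [set w | (2 * a + 2 * e - m <= v n w)%R] +
    P ([set w | (v n w <= m)%R] `&` stays_below v a n) <=
   P (large_step v e n) + P [set w | (v n w <= m)%R])%E.
Proof.
move=> e0 v0; rewrite split_below addeA; apply: leeD2r.
have mO := measurable_large_step e n mv.
apply: le_trans (measureU2 P mO mreflected).
apply: le_measure; rewrite ?inE//; first exact: measurable_set_ler.
  exact: measurableU.
move=> w /= vn.
have [k kn [ak bk]] : exists2 k, (k <= n)%N & first_passage v a k w.
  apply: first_passage_exists => /(_ n (leqnn n)); apply/negP; rewrite -leNgt.
  by move: vn ma e0; lra.
have [big|nbig] := pselect (large_step v e n w); [by left|right].
exists k => //; split; first by split.
case: k kn ak bk => [|k] kn ak bk; first by move: (v0 w); rewrite ltNge ak.
have vk : v k w < a by exact: bk.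
have : v k.+1 w <= v k w + e.
  by rewrite leNgt; apply/negP => H; apply: nbig; exists k.
by move=> /= ?; lra.
Qed.

End discrete_reflection.

(** * Reflection of Brownian motion along a time grid *)

Section brownian_reflection.
Context (d : measure_display) (Omega : measurableType d) (R : realType).
Variables (P : probability Omega R) (W : R -> {RV P >-> R}).
Hypothesis hW : standard_brownian_motion P W.

(** The case [s = t] is separate: the increment then vanishes identically,
    whereas [normal_prob 0 0] is not the Dirac mass at 0. *)
Lemma brownian_increment_opp (s t : R) (B : set R) :
  0 <= s -> s <= t -> measurable B ->
  P ((\- (W t \- W s)) @^-1` B) = P ((W t \- W s) @^-1` B).
Proof.
move=> s0; rewrite le_eqVlt => /predU1P[<- mB|st mB].
  by congr (P _); apply/seteqP; split => w /=; rewrite subrr oppr0.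
case: hW => _ _ law _.
have mBN : measurable ((-%R : R -> R) @^-1` B).
  by rewrite -[X in measurable X]setTI; exact: oppr_measurable.
have := law s t s0 st _ mBN; rewrite /pushforward => lawN.
transitivity (normal_prob 0 (Num.sqrt (t - s)) (-%R @^-1` B)); first exact: lawN.
rewrite normal_prob_opp//; last by rewrite gt_eqF// sqrtr_gt0 subr_gt0.
by rewrite -(law s t s0 st _ mB).
Qed.

(** A pi-system generating the past of the grid up to time [t k]. The full set
    in the last slot leaves room for the next increment, so that one mutual
    independence statement covers the past and this increment. *)
Definition increment_rectangles (t : nat -> R) k : set (set Omega) :=
  [set A | exists B : 'I_k.+1 -> set R, [/\ forall i, measurable (B i),
    B ord_max = setT &
    A = \bigcap_(i : 'I_k.+1) ((W (t i.+1) \- W (t i)) @^-1` B i)]].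

Lemma measurable_increment_preimage (s t : R) (B : set R) : measurable B ->
  measurable ((W t \- W s) @^-1` B).
Proof.
move=> mB; rewrite -[X in measurable X]setTI.
by apply: measurable_funB.
Qed.

Lemma increment_rectangles_measurable t k :
  increment_rectangles t k `<=` measurable.
Proof.
move=> _ [B [mB _ ->]]; apply: fin_bigcap_measurable => // i _.
exact: measurable_increment_preimage.
Qed.

Lemma increment_rectangles_setT t k : increment_rectangles t k setT.
Proof.
exists (fun=> setT); split => //.
by apply/seteqP; split.
Qed.

Lemma increment_rectangles_setI t k : setI_closed (increment_rectangles t k).
Proof.
move=> _ _ [B [mB BT ->]] [C [mC CT ->]].
exists (fun i => B i `&` C i); split.
- by move=> i; exact: measurableI.
- by rewrite BT CT setIT.
- by rewrite -bigcapI; apply: eq_bigcapr => i _; rewrite preimage_setI.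
Qed.

Lemma increment_rectangles_preimage t k j (B : set R) : (j < k)%N ->
  measurable B ->
  increment_rectangles t k ((W (t j.+1) \- W (t j)) @^-1` B).
Proof.
move=> jk mB; have jk1 : (j < k.+1)%N by exact: ltnW.
exists (fun i => if i == Ordinal jk1 then B else setT); split.
- by move=> i; case: ifP.
- by case: ifP => // /eqP/(congr1 val)/= kj; move: jk; rewrite -kj ltnn.
- apply/seteqP; split => [w Bw i _ /=|w /(_ (Ordinal jk1) I)/=].
    by case: ifP => // /eqP ->.
  by rewrite eqxx.
Qed.

Lemma increment_rectangles_independent (t : nat -> R) k A (C : set R) :
  0 <= t 0%N -> {homo t : i j / (i <= j)%N >-> i <= j} ->
  increment_rectangles t k A -> measurable C ->
  P (A `&` (W (t k.+1) \- W (t k)) @^-1` C) =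
  (P A * P ((W (t k.+1) \- W (t k))%R @^-1` C))%E.
Proof.
move=> t0 tmono [B [mB BT ->]] mC.
case: hW => _ /(_ k.+1 t t0 tmono) ind _ _.
pose B' i := if i == ord_max then C else B i.
have mB' i : measurable (B' i) by rewrite /B'; case: ifP.
have -> : (\bigcap_(i : 'I_k.+1) ((W (t i.+1) \- W (t i)) @^-1` B i)) `&`
    (W (t k.+1) \- W (t k)) @^-1` C =
    \bigcap_(i : 'I_k.+1) ((W (t i.+1) \- W (t i)) @^-1` B' i).
  apply/seteqP; split => [w [wB wC] i _|w wB'].
    rewrite /B'; case: ifP => [/eqP ->//|_]; exact: wB.
  split; last by have := wB' ord_max I; rewrite /B' eqxx.
  move=> i _; have := wB' i I; rewrite /B'; case: ifP => // /eqP -> _.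
  by rewrite BT.
rewrite (ind B' mB') (ind B mB) (bigD1 ord_max)//= [in RHS](bigD1 ord_max)//=.
rewrite BT preimage_setT probability_setT mul1e /B' eqxx muleC.
congr (_ * _)%E; apply: eq_bigr => i /negbTE ik.
by rewrite ik.
Qed.

Lemma brownian_grid_reflection (t : nat -> R) (a m : R) (n k : nat) :
  0 <= t 0%N -> {homo t : i j / (i <= j)%N >-> i <= j} -> (k <= n)%N ->
  let v j w := W (t j) w - W (t 0%N) w in
  P (first_passage v a k `&` [set w | v n w <= m]) =
  P (first_passage v a k `&` [set w | 2 * v k w - v n w <= m]).
Proof.
move=> t0 tmono kn v.
(* Along [u] the increment that follows time [t k] is the whole remainder. *)
pose u j := if (j <= k)%N then t j else t n.
have u0 : 0 <= u 0%N by [].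
have umono : {homo u : i j / (i <= j)%N >-> i <= j}.
  move=> i j ij; rewrite /u; case: (leqP j k) => jk.
    by rewrite (leq_trans ij jk) tmono.
  by case: leqP => // ik; rewrite tmono// (leq_trans ik).
have ut j : (j <= k)%N -> u j = t j by rewrite /u => ->.
have uS : u k.+1 = t n by rewrite /u ltnn.
pose G := increment_rectangles u k.
have Gm : G `<=` measurable by exact: increment_rectangles_measurable.
pose D := (W (t n) \- W (t k) : Omega -> R).
have mD : measurable_fun setT D by apply: measurable_funB.
have mv j : (j <= k)%N -> measurable_fun [set: g_sigma_algebraType G] (v j).
  elim: j => [_|j IH jk].
    rewrite (_ : v 0%N = cst 0); first exact: measurable_cst.
    by apply/funext => w; rewrite /v subrr.
  rewrite (_ : v j.+1 = (W (u j.+1) \- W (u j)) \+ v j); last first.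
    by apply/funext => w; rewrite /v /= !ut// ?(ltnW jk)// addrA subrK.
  apply: measurable_funD; last by apply: IH; exact: ltnW.
  move=> _ B mB; rewrite setTI; apply: sub_sigma_algebra.
  exact: increment_rectangles_preimage.
rewrite [X in P (_ `&` X) = _](_ : _ = [set w | v k w + D w <= m]); last first.
  by apply/seteqP; split => w /=; rewrite /v /D /=; lra.
rewrite [X in _ = P (_ `&` X)](_ : _ = [set w | v k w - D w <= m]); last first.
  by apply/seteqP; split => w /=; rewrite /v /D /=; lra.
apply: (@independent_symmetric_swap _ _ _ _ G) => //.
- have := @measurable_first_passage _ (g_sigma_algebraType G) R v a k.
  by apply => j jk; exact: mv.
- exact: mv.
- move=> A B sA mB.
  apply: (@independent_g_sigma _ _ _ _ G) => //.
  + exact: increment_rectangles_setT.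
  + exact: increment_rectangles_setI.
  + exact: measurable_increment_preimage.
  + move=> A' GA'.
    by have := increment_rectangles_independent u0 umono GA' mB; rewrite uS ut.
- move=> B mB; apply: brownian_increment_opp => //; last exact: tmono.
  by rewrite (le_trans t0)// tmono.
Qed.

End brownian_reflection.

(** * Comparison of expectations with probabilities of events *)

Section null_sandwich.
Context (d : measure_display) (Omega : measurableType d) (R : realType).
Variable P : probability Omega R.
Implicit Types (f g : Omega -> R) (A : nat -> set Omega).

(** The probability of the limit superior is the decreasing limit of the
    probabilities of the unions of the tails. *)
Lemma probability_lim_sup_set_ge A (c : \bar R) :
  (forall n, measurable (A n)) -> (forall n, (c <= P (A n))%E) ->
  (c <= P (lim_sup_set A))%E.
Proof.
move=> mA cA.
have mU n : measurable (\bigcup_(k >= n) A k) by exact: bigcup_measurable.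
have finU : (P (\bigcup_(k >= 0) A k) < +oo)%E.
  by rewrite (le_lt_trans (probability_le1 _ _)) ?ltry.
have cv := lim_sup_set_cvg P A mA finU.
rewrite -(cvg_lim _ cv)//; apply: lime_ge; first by apply/cvg_ex; eexists; exact: cv.
apply: nearW => n; apply: le_trans (cA n) _.
by apply: le_measure; rewrite ?inE// => w Aw; exists n => //=.
Qed.

(** The integral of a nonnegative function is a supremum over the simple
    functions below it, hence is monotone on arbitrary functions. *)
Lemma ge0_le_expectation f g :
  (forall w, 0 <= f w) -> (forall w, f w <= g w) -> ('E_P[f] <= 'E_P[g])%E.
Proof.
move=> f0 fg; rewrite unlock.
have g0 w : 0 <= g w by exact: le_trans (fg w).
rewrite !ge0_integralTE; [|by move=> w; rewrite lee_fin..].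
apply: le_ereal_sup => _ [h hf <-]; exists h => // w.
by rewrite (le_trans (hf w))// lee_fin.
Qed.

Lemma expectation_le_probability f (B N : set Omega) :
  measurable B -> P.-negligible N -> (forall w, 0 <= f w <= 1) ->
  (forall w, ~ N w -> f w != 0 -> B w) -> ('E_P[f] <= P B)%E.
Proof.
move=> mB [M [mM M0 NM]] f01 fB.
have mBM : measurable (B `|` M) by exact: measurableU.
apply: (@le_trans _ _ 'E_P[\1_(B `|` M)])%E.
  apply: ge0_le_expectation => w; first by case/andP: (f01 w).
  rewrite indicE; have [Bw|nBw] := boolP (w \in B `|` M).
    by case/andP: (f01 w).
  have [->//|/fB Bw] := eqVneq (f w) 0.
  move: nBw; rewrite notin_setE => -[]; have [Mw|nMw] := pselect (M w).
    by right.
  by left; apply: Bw => /NM.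
rewrite expectation_indic//; apply: le_trans (measureU2 P mB mM) _.
by rewrite [X in (_ + X <= _)%E](_ : _ = 0%E) ?adde0.
Qed.

Lemma probability_le_expectation f (B N : set Omega) :
  measurable B -> P.-negligible N -> (forall w, 0 <= f w) ->
  (forall w, ~ N w -> B w -> 1 <= f w) -> (P B <= 'E_P[f])%E.
Proof.
move=> mB [M [mM M0 NM]] f0 fB.
have mBM : measurable (B `\` M) by exact: measurableD.
have mBI : measurable (B `&` M) by exact: measurableI.
apply: (@le_trans _ _ 'E_P[\1_(B `\` M)])%E; last first.
  apply: ge0_le_expectation => w; first by rewrite indicE.
  rewrite indicE; have [|_] := boolP (w \in B `\` M); last exact: f0.
  by rewrite inE => -[Bw nMw]; apply: fB => // /NM.
rewrite expectation_indic// (measureDI P mB mM).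
rewrite [X in (_ + X <= _)%E](_ : _ = 0%E) ?adde0//.
by apply: subset_measure0 M0 => // w [].
Qed.

End null_sandwich.

(** * Continuous paths sampled on a grid *)

Section paths.
Context (R : realType).
Implicit Types f : R -> R.

(** Heine's theorem, with [t] allowed to go beyond [b]: in
    [below_grid_below] this controls the path slightly after time [T], as a
    strict inequality between [T] and [zeta] requires. *)
Lemma unif_continuous_halfline f (b e : R) :
  {within `[0, +oo[, continuous f} -> 0 < e ->
  exists2 r, 0 < r & forall s t, 0 <= s -> s <= b -> 0 <= t ->
    `|s - t| < r -> `|f s - f t| < e.
Proof.
move=> cf e0.
pose Q r s := 0 <= s -> forall t, 0 <= t -> `|s - t| < r -> `|f s - f t| < e.
have : \forall r \near 0^'+, `[0, b] `<=` Q r.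
  have /compact_near_coveringP cpt := @segment_compact R 0 b.
  apply: cpt => s0; rewrite /= in_itv/= => /andP[s00 _].
  have e2 : 0 < e / 2 by rewrite divr_gt0.
  have /subspace_continuousP/(_ s0) := cf.
  rewrite /= in_itv/= andbT s00 => /(_ isT)/cvgrPdist_lt/(_ _ e2).
  rewrite near_withinE => /nbhs_ballP[rho /= rho0 H].
  have rho2 : 0 < rho / 2 by rewrite divr_gt0.
  exists (ball s0 (rho / 2), [set r | r < rho / 2]).
    split; first exact: nbhsx_ballx.
    exact: nbhs_right_lt.
  move=> [s r] /= [s0s rr] sge t t0 str.
  have Hs : `|f s0 - f s| < e / 2.
    apply: H; last by rewrite in_itv/= sge.
    by rewrite /ball/= (lt_trans s0s)// ltr_pdivrMr// ltr_pMr// ltr1n.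
  have Ht : `|f s0 - f t| < e / 2.
    apply: H; last by rewrite in_itv/= t0.
    rewrite /ball/= -(subrKA s) (le_lt_trans (ler_normD _ _))//.
    by rewrite [ltRHS]splitr ltrD// (lt_trans str).
  rewrite -(subrKA (f s0)) (le_lt_trans (ler_normD _ _))//.
  by rewrite [ltRHS]splitr ltrD// distrC.
move=> near; have [r [r0 Qr]] : exists r, 0 < r /\ `[0, b] `<=` Q r.
  have := @filter_ex _ (0^'+ : set_system R) _ _ (filterI (nbhs_right_gt 0) near).
  by case=> r [r0 Qr]; exists r.
exists r => // s t s0 sb t0 str; apply: (Qr s) => //.
by rewrite /= in_itv/= s0.
Qed.

End paths.

Section grid.
Context (R : realType).
Implicit Types (T r e a : R) (f : R -> R).

Definition grid T n j : R := T * (j%:R / n.+1%:R).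

Lemma grid0 T n : grid T n 0 = 0.
Proof. by rewrite /grid mul0r mulr0. Qed.

Lemma grid_last T n : grid T n n.+1 = T.
Proof. by rewrite /grid divff ?mulr1// pnatr_eq0. Qed.

Lemma grid_homo T n : 0 <= T -> {homo grid T n : i j / (i <= j)%N >-> i <= j}.
Proof.
move=> T0 i j ij; rewrite /grid ler_wpM2l// ler_wpM2r ?invr_ge0//.
by rewrite ler_nat.
Qed.

Lemma grid_ge0 T n j : 0 <= T -> 0 <= grid T n j.
Proof. by move=> T0; rewrite -(grid0 T n) grid_homo. Qed.

Lemma grid_step T n j : grid T n j.+1 - grid T n j = T / n.+1%:R.
Proof. by rewrite /grid -mulrBr -mulrBl -natr1 addrAC subrr add0r mul1r. Qed.

Lemma grid_mesh_lt T r : 0 < T -> 0 < r ->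
  exists n0, forall n, (n0 <= n)%N -> T / n.+1%:R < r.
Proof.
move=> T0 r0; exists (Num.truncn (T / r)) => n n0n.
rewrite ltr_pdivrMr// mulrC -ltr_pdivrMr//.
apply: lt_le_trans (truncnS_gt _) _.
by rewrite ler_nat ltnS.
Qed.

(** The nearest grid point on the left. *)
Lemma grid_near T n t : 0 < T -> 0 <= t -> t <= T ->
  exists2 j, (j <= n.+1)%N & `|grid T n j - t| <= T / n.+1%:R.
Proof.
move=> T0 t0 tT; pose x := t / T * n.+1%:R.
have n0 : 0 < n.+1%:R :> R by rewrite ltr0n.
have x0 : 0 <= x by rewrite mulr_ge0// divr_ge0// ltW.
have /andP[jx xj] := truncn_itv x0.
exists (Num.truncn x).
  rewrite -(ler_nat R); apply: le_trans jx _.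
  by rewrite /x ler_piMl ?(ltW n0)// ler_pdivrMr// mul1r.
have -> : t = T * (x / n.+1%:R).
  by rewrite /x mulfK ?gt_eqF// mulrC divfK// gt_eqF.
rewrite /grid -mulrBr -mulrBl normrM (gtr0_norm T0) ler_pM2l//.
rewrite normrM (gtr0_norm (_ : 0 < n.+1%:R^-1)) ?invr_gt0//.
rewrite -[leRHS]mul1r ler_pM2r ?invr_gt0// ler0_norm ?subr_le0//.
by rewrite opprB lerBlDr addrC natr1 ltW.
Qed.

Lemma grid_steps_small f T e : {within `[0, +oo[, continuous f} ->
  0 < T -> 0 < e ->
  exists n0, forall n, (n0 <= n)%N -> forall j, (j <= n)%N ->
    f (grid T n j.+1) <= f (grid T n j) + e.
Proof.
move=> cf T0 e0; have [r r0 unif] := unif_continuous_halfline T cf e0.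
have [n0 mesh] := grid_mesh_lt T0 r0; exists n0 => n /mesh Tn j jn.
have gT : grid T n j.+1 <= T.
  by rewrite -[leRHS](grid_last T n) grid_homo// ltW.
have dist : `|grid T n j.+1 - grid T n j| < r.
  by rewrite grid_step gtr0_norm// divr_gt0.
have := unif _ _ (grid_ge0 n j.+1 (ltW T0)) gT (grid_ge0 n j (ltW T0)) dist.
by rewrite ltr_norml => /andP[_ /ltW]; rewrite lerBlDl.
Qed.

Lemma below_grid_below f T a e : {within `[0, +oo[, continuous f} ->
  0 < T -> 0 < e ->
  exists n0, exists2 r, 0 < r & forall n, (n0 <= n)%N ->
    (forall j, (j <= n.+1)%N -> f (grid T n j) < a - e) ->
    forall t, 0 <= t -> t <= T + r -> f t < a.
Proof.
move=> cf T0 e0; have [r r0 unif] := unif_continuous_halfline T cf e0.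
have [n0 mesh] := grid_mesh_lt T0 r0; exists n0, (r / 2); first exact: divr_gt0.
move=> n /mesh Tn below t t0 tTr.
have [j jn jt] : exists2 j, (j <= n.+1)%N & `|grid T n j - t| < r.
  have [tT|Tt] := leP t T.
    have [j jn jt] := @grid_near T n t T0 t0 tT.
    by exists j => //; exact: le_lt_trans Tn.
  exists n.+1 => //; rewrite grid_last distrC ger0_norm; lra.
have gT : grid T n j <= T by rewrite -[leRHS](grid_last T n) grid_homo// ltW.
have := unif _ _ (grid_ge0 n j (ltW T0)) gT t0 jt.
rewrite ltr_norml => /andP[H _]; have := below j jn; lra.
Qed.

End grid.

(** * The coalescence time as a hitting time *)

Section hitting_time.
Context (R : realType) (Omega : Type).
Variables (W : R -> Omega -> R) (mu z y T : R) (w : Omega).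
Let a := (y - z) / 2.

Lemma Zproc_eq_Yproc t :
  Zproc mu z W t w = Yproc mu y W t w <-> W t w = a.
Proof. by rewrite /Zproc /Yproc /a; split; lra. Qed.

(** By the intermediate value theorem, a path started at 0 that is at or above
    [a] at time [t] has met [a] before. *)
Lemma zeta_gt_below : {within `[0, +oo[, continuous (fun t => W t w)} ->
  W 0 w = 0 -> z < y -> (T%:E < zeta mu z y W w)%E ->
  forall t, 0 <= t -> t <= T -> W t w < a.
Proof.
move=> cW W0 zy Tz t t0 tT; rewrite ltNge; apply/negP => at_.
have a0 : 0 < a by rewrite /a; lra.
have cW' : {within `[0, t], continuous (fun t => W t w)}.
  by apply: continuous_subspaceW cW => s /=; rewrite !in_itv/= => /andP[->].
have [|s] := IVT (v := a) t0 cW'.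
  have Wt0 : 0 <= W t w by apply: le_trans at_; exact: ltW.
  by rewrite W0 min_l// max_r// at_ ltW.
rewrite in_itv/= => /andP[s0 st] Ws.
suff : (zeta mu z y W w <= T%:E)%E by rewrite leNgt Tz.
apply: (@le_trans _ _ s%:E); last by rewrite lee_fin (le_trans st).
apply: ereal_inf_lbound; exists s => //; split => //.
exact/Zproc_eq_Yproc.
Qed.

Lemma below_zeta_gt r : 0 < r ->
  (forall t, 0 <= t -> t <= T + r -> W t w < a) -> (T%:E < zeta mu z y W w)%E.
Proof.
move=> r0 below; apply: (@lt_le_trans _ _ (T + r)%:E).
  by rewrite lte_fin ltrDl.
apply: le_ereal_inf_tmp => _ [t [t0 /Zproc_eq_Yproc Wt] <-].
rewrite lee_fin leNgt; apply/negP => /ltW tTr.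
by have := below t t0 tTr; rewrite Wt ltxx.
Qed.

End hitting_time.

(** * Distribution function of a centred normal variable *)

Section distribution_function.
Context (d : measure_display) (Omega : measurableType d) (R : realType).
Variables (P : probability Omega R) (V : Omega -> R).
Hypothesis mV : measurable_fun setT V.

Definition dfun (c : R) : R := fine (P [set w | V w <= c]).

Lemma dfunE c : P [set w | V w <= c] = (dfun c)%:E.
Proof.
by rewrite fineK// fin_num_measure//; exact: measurable_set_ler.
Qed.

Lemma dfun_nondecreasing : {homo dfun : x y / x <= y}.
Proof.
move=> b c bc; rewrite -lee_fin -!dfunE; apply: le_measure; rewrite ?inE;
  [exact: measurable_set_ler..|].
by move=> w /= /le_trans; apply.
Qed.

Lemma dfun_right_continuous (c h : R) : 0 < h ->
  exists2 e : R, 0 < e & dfun (c + e) <= dfun c + h.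
Proof.
move=> h0; pose X : {RV P >-> R} := mfun_Sub (mem_set mV).
have XE b : cdf X b = (dfun b)%:E.
  by rewrite -dfunE /cdf /distribution /pushforward; congr (P _).
have cv : dfun r @[r --> c^'+] --> dfun c.
  have -> : dfun = fine \o cdf X by apply/funext => b /=; rewrite XE.
  by apply: fine_cvg; rewrite [in X in _ --> X]/= XE /= -XE;
    exact: cdf_right_continuous.
have /cvgrPdist_le/(_ _ h0) near := cv.
have := @filter_ex _ (c^'+ : set_system R) _ _ (filterI (nbhs_right_gt c) near).
case=> r [/= cr H]; exists (r - c); first by rewrite subr_gt0.
rewrite addrC subrK; move: H; rewrite distrC ler_norml => /andP[_].
by rewrite lerBlDl.
Qed.

Lemma normal_upper_tail s : (forall B : set R, measurable B ->
    P (V @^-1` B) = normal_prob 0 s B) -> s != 0 ->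
  forall c, P [set w | c <= V w] = P [set w | V w <= - c].
Proof.
move=> law s0 c; rewrite (_ : [set w | c <= V w] = V @^-1` `[c, +oo[); last first.
  by apply/seteqP; split => w /=; rewrite in_itv/= andbT.
rewrite (_ : [set w | V w <= - c] = V @^-1` `]-oo, - c]); last first.
  by apply/seteqP; split => w /=; rewrite in_itv.
rewrite !law//.
rewrite -normal_prob_opp//; congr (normal_prob _ _ _).
by apply/seteqP; split => r /=; rewrite !in_itv/= andbT lerNr.
Qed.

Lemma normal_dfunN s : (forall B : set R, measurable B ->
    P (V @^-1` B) = normal_prob 0 s B) -> s != 0 ->
  forall c, dfun (- c) = 1 - dfun c.
Proof.
move=> law s0 c; apply/EFin_inj; rewrite -dfunE -(normal_upper_tail law s0).
have mA : measurable [set w | V w <= c] by exact: measurable_set_ler.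
have mB : measurable [set w | c <= V w] by exact: measurable_set_ler.
rewrite EFinB -dfunE -probability_setC//.
rewrite (measureDI P mB mA) [X in (_ + X)%E](_ : _ = 0%E) ?adde0.
  congr (P _); apply/seteqP; split => w /=.
    by case.
  by move=> /negP; rewrite -ltNge => cV; split; [exact: ltW|apply/negP; rewrite -ltNge].
transitivity (P (V @^-1` [set c])); last by rewrite law// normal_prob_set1.
congr (P _); apply/seteqP; split => w /=; last by move=> ->; rewrite lexx.
by case=> H1 H2; apply/eqP; rewrite eq_le H2.
Qed.

End distribution_function.

(** * Brownian motion killed at a level *)

Definition irregular_paths (R : realType) (Omega : Type) (W : R -> Omega -> R) :
    set Omega :=
  ~` [set w | W 0 w = 0 /\ {within `[0, +oo[, continuous (fun t => W t w)}].

Section killed_brownian_motion.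
Context (d : measure_display) (Omega : measurableType d) (R : realType).
Variables (P : probability Omega R) (W : R -> {RV P >-> R}).
Hypothesis hW : standard_brownian_motion P W.
Variables (T : R).
Hypothesis T0 : 0 < T.

Let V w := W T w - W 0 w.
Let N := irregular_paths W.

Lemma brownian_endpoint_measurable : measurable_fun setT V.
Proof. exact: measurable_funB. Qed.

Lemma brownian_endpoint_law (B : set R) : measurable B ->
  P (V @^-1` B) = normal_prob 0 (Num.sqrt T) B.
Proof.
move=> mB; case: hW => _ _ law _.
by have := law 0 T (lexx _) T0 B mB; rewrite subr0.
Qed.

Lemma brownian_irregular_negligible : P.-negligible N.
Proof.
case: hW => W0 _ _ cW.
apply: negligibleS (negligibleU W0 cW) => w /= /not_andP[H|H]; [by left|by right].
Qed.

(** The functional [f] stands for the indicator of [W] staying below [a] until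
    [T] and ending below [m]. It is only pinned down off the irregular paths,
    and the value [W T = m] is left open, so that strict and weak inequalities
    at the endpoint are treated at once. *)
Variables (a m : R) (f : Omega -> R).
Hypothesis a0 : 0 < a.
Hypothesis ma : m <= a.
Hypothesis f01 : forall w, 0 <= f w <= 1.
Hypothesis f_support : forall w, ~ N w -> f w != 0 ->
  W T w <= m /\ forall t, 0 <= t -> t <= T -> W t w < a.
Hypothesis f_one : forall w, ~ N w -> W T w < m ->
  (exists2 r, 0 < r & forall t, 0 <= t -> t <= T + r -> W t w < a) -> 1 <= f w.

Let v n j w := W (grid T n j) w - W (grid T n 0) w.

Let mv n k : measurable_fun setT (v n k).
Proof. exact: measurable_funB. Qed.

Let mV := brownian_endpoint_measurable.

Let v_last n : v n n.+1 = V.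
Proof. by apply/funext => w; rewrite /v grid_last grid0. Qed.

Let refl n b c k : (k <= n.+1)%N ->
  P (first_passage (v n) b k `&` [set w | v n n.+1 w <= c]) =
  P (first_passage (v n) b k `&` [set w | 2 * v n k w - v n n.+1 w <= c]).
Proof.
move=> kn; apply: brownian_grid_reflection => //; first exact/grid_ge0/ltW.
exact/grid_homo/ltW.
Qed.

Let v_regular w n j : ~ N w -> v n j w = W (grid T n j) w.
Proof. by move=> /contrapT[W0 _]; rewrite /v grid0 W0 subr0. Qed.

Let V_regular w : ~ N w -> V w = W T w.
Proof. by move=> /contrapT[W0 _]; rewrite /V W0 subr0. Qed.

(** A continuous path is uniformly continuous on [[0, T]], so it makes large
    grid steps for finitely many [n] only; probabilities bounded away from 0
    would give the limit superior of these events a positive probability. *)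
Lemma large_steps_vanish e h : 0 < e -> 0 < h ->
  exists n, (P (large_step (v n) e n.+1) < h%:E)%E.
Proof.
move=> e0 h0; apply: contrapT => none.
have mO n : measurable (large_step (v n) e n.+1) by exact: measurable_large_step.
have hO n : (h%:E <= P (large_step (v n) e n.+1))%E.
  by rewrite leNgt; apply/negP => ?; apply: none; exists n.
have := probability_lim_sup_set_ge mO hO; rewrite measure_negligible.
- by rewrite lee_fin leNgt h0.
- by apply: bigcapT_measurable => n; exact: bigcup_measurable.
- apply: negligibleS brownian_irregular_negligible => w Ow; apply: contrapT => Nw.
  have /contrapT[_ cW] := Nw.
  have [n0 small] := grid_steps_small cW T0 e0.
  have [n /= /small step [j jn]] := Ow n0 I.
  by rewrite !v_regular// ltNge step.
Qed.

Lemma killed_expectation_le e : 0 < e ->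
  ('E_P[f] + P [set w | (2 * a + 2 * e - m <= V w)%R] <=
   P [set w | (V w <= m)%R])%E.
Proof.
move=> e0; apply/lee_addgt0Pr => h h0.
have [n /ltW On] := large_steps_vanish e0 h0.
have v0 w : v n 0 w < a by rewrite /v subrr.
have := discrete_reflection_ge (mv n) ma (@refl n a m)
  (ltW e0) v0.
rewrite v_last => H.
apply: (@le_trans _ _ (P [set w | (2 * a + 2 * e - m <= V w)%R] +
    P ([set w | (V w <= m)%R] `&` stays_below (v n) a n.+1))%E).
  rewrite addeC; apply: leeD2l.
  apply: (expectation_le_probability _ brownian_irregular_negligible) => //.
    apply: measurableI; first exact: measurable_set_ler.
    exact: measurable_stays_below.
  move=> w Nw /(f_support Nw)[Wm below]; split.
    by rewrite /= V_regular.
  move=> j jn; rewrite v_regular//; apply: below; first exact/grid_ge0/ltW.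
  by rewrite -[leRHS](grid_last T n) grid_homo// ltW.
by apply: le_trans H _; rewrite addeC; exact: leeD2l.
Qed.

(** Lowering both levels by [e] leaves room for the oscillation of the path
    between grid times. *)
Lemma killed_expectation_ge e : 0 < e ->
  (P [set w | (V w <= m - e)%R] <=
   P [set w | (2 * a - m - e <= V w)%R] + 'E_P[f])%E.
Proof.
move=> e0; have mae : m - e <= a - e by rewrite lerB.
pose A n := [set w | (V w <= m - e)%R] `&` stays_below (v n) (a - e) n.+1.
have mA n : measurable (A n).
  apply: measurableI; first exact: measurable_set_ler.
  exact: measurable_stays_below.
have mH : measurable [set w | 2 * a - m - e <= V w] by exact: measurable_set_ler.
have mL : measurable [set w | V w <= m - e] by exact: measurable_set_ler.
rewrite addeC -leeBlDr ?fin_num_measure//.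
apply: (@le_trans _ _ (P (lim_sup_set A))).
  apply: probability_lim_sup_set_ge => // n.
  rewrite leeBlDr ?fin_num_measure// addeC.
  have := discrete_reflection_le (mv n)
    (@refl n (a - e) (m - e)).
  by rewrite v_last (_ : 2 * (a - e) - (m - e) = 2 * a - m - e)//; lra.
apply: (probability_le_expectation _ brownian_irregular_negligible).
- by apply: bigcapT_measurable => n; exact: bigcup_measurable.
- by move=> w; case/andP: (f01 w).
- move=> w Nw Aw; have /contrapT[_ cW] := Nw.
  have [n0 [r r0 H]] := below_grid_below a cW T0 e0.
  have [n /= n0n [Vw below]] := Aw n0 I.
  apply: f_one => //; first by move: Vw; rewrite /= V_regular//; lra.
  by exists r => //; apply: (H n n0n) => j jn; rewrite -v_regular//; exact: below.
Qed.

(** In the limit [e -> 0] the bounds meet. Right-continuity of the distribution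
    function is enough: a limit from the left at [c] is one from the right at
    [- c] by [normal_dfunN]. *)
Lemma killed_expectation :
  ('E_P[f] = (dfun P V m + dfun P V (2 * a - m) - 1)%:E)%E.
Proof.
have s0 : Num.sqrt T != 0 by rewrite gt_eqF// sqrtr_gt0.
have opp := normal_upper_tail brownian_endpoint_law s0.
have dN := normal_dfunN mV brownian_endpoint_law s0.
have E0 : (0 <= 'E_P[f])%E.
  by rewrite unlock; apply: integral_ge0 => w _; rewrite lee_fin; case/andP: (f01 w).
have := killed_expectation_le ltr01; have := killed_expectation_ge.
have := killed_expectation_le.
case: ('E_P[f])%E E0 => [x|//|//] x0 up lo _; last first.
  by have := up 1 ltr01; rewrite opp !dfunE//.
congr EFin; apply/eqP; rewrite eq_le; apply/andP; split; apply/ler_addgt0Pr => h h0.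
  have [e e0 He] := dfun_right_continuous P mV (2 * a - m) h0.
  have e20 : 0 < e / 2 by lra.
  have := up _ e20; rewrite opp !dfunE// -EFinD lee_fin dN.
  rewrite (_ : 2 * a + 2 * (e / 2) - m = 2 * a - m + e); last by lra.
  move: He; lra.
have h20 : 0 < h / 2 by lra.
have [e1 e10 He1] := dfun_right_continuous P mV (- m) h20.
have [e2 e20 He2] := dfun_right_continuous P mV (- (2 * a - m)) h20.
pose e := Num.min e1 e2.
have e0 : 0 < e by rewrite lt_min e10.
have := lo e e0; rewrite opp !dfunE// -EFinD lee_fin.
have H1 : dfun P V (- m + e) <= dfun P V (- m + e1).
  by apply: dfun_nondecreasing => //; rewrite lerD2l ge_min lexx.
have H2 : dfun P V (- (2 * a - m) + e) <= dfun P V (- (2 * a - m) + e2).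
  by apply: dfun_nondecreasing => //; rewrite lerD2l ge_min lexx orbT.
rewrite (_ : m - e = - (- m + e)); last by lra.
rewrite (_ : - (2 * a - m - e) = - (2 * a - m) + e); last by lra.
rewrite dN; move: He1 He2 H1 H2; rewrite !dN; lra.
Qed.

End killed_brownian_motion.

(** * The duality identity *)

Theorem theorem1p1 (R : realType) (d : measure_display)
    (Omega : measurableType d) (P : probability Omega R)
    (W : R -> {RV P >-> R}) (mu T x z y : R)
    (hW : standard_brownian_motion P W) (hT : 0 < T) (hzy : z < y) :
  ('E_P[fun w => Gamma (Some (z, y)) (Xhat mu x W T w)]
    = 'E_P[fun w => Gamma (Xstar mu z y W T w) x])%E.
Proof.
pose c1 := x - z - mu * T; pose c2 := y + mu * T - x.
pose a := (y - z) / 2; pose m := Num.min c1 c2.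
have a0 : 0 < a by rewrite /a; lra.
have ma : m <= a by rewrite /m ge_min /a /c1 /c2; lra.
pose V w := W T w - W 0 w.
have mV : measurable_fun setT V by exact: brownian_endpoint_measurable.
have s0 : Num.sqrt T != 0 by rewrite gt_eqF// sqrtr_gt0.
have dN := normal_dfunN mV (brownian_endpoint_law hW hT) s0.
have Gamma01 p (u : R) : 0 <= Gamma p u <= 1.
  by case: p => [[? ?]|] /=; [case: ifP|]; rewrite ?lexx ?ler01.
rewrite [RHS](killed_expectation hW hT a0 ma); first last.
- move=> w Nw Wm [r r0 below].
  have Tz : (T%:E < zeta mu z y W w)%E by exact: below_zeta_gt r0 below.
  rewrite /Xstar; case: ifPn => [_ /=|/negP[]//]; rewrite ifT//.
  by move: Wm; rewrite /m lt_min /Zproc /Yproc /c1 /c2 => /andP[]; lra.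
- move=> w /contrapT[W0 cW]; rewrite /Xstar; case: ifP; last by rewrite eqxx.
  move=> Tz /=; case: ifP; last by rewrite eqxx.
  move=> /andP[zx xy] _; split.
    by move: zx xy; rewrite /m le_min /Zproc /Yproc /c1 /c2 => zx xy; lra.
  by move=> t t0 tT; exact: zeta_gt_below Tz t t0 tT.
- by [].
pose B := [set w | V w <= c2] `\` [set w | V w <= - c1].
have m1 : measurable [set w | V w <= c2] by exact: measurable_set_ler.
have m2 : measurable [set w | V w <= - c1] by exact: measurable_set_ler.
have mB : measurable B by exact: measurableD.
have PB : P B = (dfun P V c2 + dfun P V c1 - 1)%:E.
  have : P [set w | V w <= c2] = (P B + P [set w | (V w <= - c1)%R])%E.
    rewrite (measureDI P m1 m2) setIidr// => w /= Vc.
    by rewrite /c2; move: Vc; rewrite /c1; lra.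
  rewrite !dfunE// dN => /eqP; rewrite -sube_eq// => [/eqP <-|].
    by rewrite -EFinB; congr EFin; lra.
  by rewrite fin_num_adde_defl.
(* [m] and [2 a - m] are [c1] and [c2] in some order. *)
have cE : dfun P V m + dfun P V (2 * a - m) = dfun P V c2 + dfun P V c1.
  rewrite /m; have [_|_] := leP c1 c2.
    by rewrite addrC (_ : 2 * a - c1 = c2)// /a /c1 /c2; lra.
  by rewrite (_ : 2 * a - c2 = c1)// /a /c1 /c2; lra.
rewrite cE -PB; apply/eqP; rewrite eq_le; apply/andP; split.
- apply: (expectation_le_probability mB (brownian_irregular_negligible hW)).
    by move=> w; exact: Gamma01.
  move=> w /contrapT[W0 _] /=; case: ifP; last by rewrite eqxx.
  rewrite /Xhat => /andP[zX Xy] _; rewrite /B /V /c1 /c2 /= W0 subr0.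
  by split; [lra|apply/negP; rewrite -ltNge; lra].
- apply: (probability_le_expectation mB (brownian_irregular_negligible hW)).
    by move=> w; case/andP: (Gamma01 (Some (z, y)) (Xhat mu x W T w)).
  move=> w /contrapT[W0 _]; rewrite /B /V /c1 /c2 /= W0 subr0 => -[V2 /negP].
  by rewrite -ltNge => V1; rewrite ifT// /Xhat; lra.
Qed.
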